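(* Let $H$ be a real Hilbert space, $C\subseteq H$ a nonempty, convex and closed set, and $F:H\to H$ an operator which is $\gamma$-strongly pseudo-monotone on $C$ with $\gamma>0$ and Lipschitz continuous with constant $L>0$. Let $0<\lambda<\frac1L$, let $x_0\in H$, and let $x,y:[0,+\infty)\to H$ be the trajectories generated by the dynamical system $$\begin{cases} y(t)=P_C(x(t)-\lambda F(x(t)))\\ \dot x(t)+x(t)=y(t)+\lambda\left[F(x(t))-F(y(t))\right]\\ x(0)=x_0.\end{cases}$$ Let $x^*$ be the unique solution of $\mathrm{VI}(F,C)$. Then for every $t\in[0,+\infty)$ $$\|x(t)-x^*\|^2\le\|x(0)-x^*\|^2\exp(-\alpha t),\qquad\text{where } \alpha:=2(1-\lambda L)\left(\frac{\lambda\gamma}{1+\lambda L+\lambda\gamma}\right)^2.$$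
   Context: $\mathrm{VI}(F,C)$ is the problem of finding $x^*\in C$ such that $\langle F(x^* ),x-x^*\rangle\ge 0$ for all $x\in C$. $P_C$ is the metric projection onto $C$. $F$ is $\gamma$-strongly pseudo-monotone on $C$ if for all $x,y\in C$: $\langle F(x),y-x\rangle\ge0\Rightarrow\langle F(y),y-x\rangle\ge\gamma\|x-y\|^2$. $F$ is Lipschitz continuous with constant $L$ if $\|F(x)-F(y)\|\le L\|x-y\|$ for all $x,y\in H$. It is known that under these assumptions $\mathrm{VI}(F,C)$ has a unique solution, and that (by the global Cauchy-Lipschitz theorem) the dynamical system has a unique trajectory $x\in C^1([0,+\infty),H)$. *)

(* Defs.v *)
From HB Require Import structures.
From mathcomp Require Import all_boot all_order all_algebra.
From mathcomp Require Import all_classical all_reals all_analysis.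

Set Implicit Arguments.
Unset Strict Implicit.
Unset Printing Implicit Defensive.

Import Order.TTheory GRing.Theory Num.Theory.
Import numFieldNormedType.Exports.

Local Open Scope classical_set_scope.
Local Open Scope ring_scope.

(* A real Hilbert space is a complete normed module [H] over a [realType]
   together with a positive definite symmetric bilinear form ([{dot H for idfun}]:
   for [theta = idfun] hermitian means symmetric) that induces its norm. *)
Definition induces_norm (R : realType) (H : normedModType R)
    (dot : {dot H for idfun}) : Prop :=
  forall u : H, `|u| ^+ 2 = dot u u.

Definition nearest_point (R : realType) (H : normedModType R)
    (C : set H) (u p : H) : Prop :=
  C p /\ forall z, C z -> `|u - p| <= `|u - z|.

(* [xget] selects the nearest point, which exists and is unique when [C] is
   nonempty, closed and convex and [H] is a Hilbert space; the default value [u]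
   is returned only if there is no nearest point. *)
Definition metric_proj (R : realType) (H : normedModType R)
    (C : set H) (u : H) : H :=
  xget u [set p | nearest_point C u p].

Definition strongly_pseudomonotone_on (R : realType) (H : normedModType R)
    (dot : {dot H for idfun}) (gamma : R) (C : set H) (F : H -> H) : Prop :=
  forall x y, C x -> C y ->
    0 <= dot (F x) (y - x) -> gamma * `|x - y| ^+ 2 <= dot (F y) (y - x).

Definition VI_solution (R : realType) (H : normedModType R)
    (dot : {dot H for idfun}) (F : H -> H) (C : set H) (xs : H) : Prop :=
  C xs /\ forall x, C x -> 0 <= dot (F xs) (x - xs).

(* Derivative relative to the domain [D]; for [D = `[0, +oo[] it is the usual
   derivative at [t > 0] and the right derivative at [t = 0]. *)
Definition is_derive_in (R : realType) (V : normedModType R)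
    (D : set R) (f : R -> V) (t : R) (v : V) : Prop :=
  (s - t)^-1 *: (f s - f t) @[s --> within D t^'] --> v.

Definition is_C1_in (R : realType) (V : normedModType R)
    (D : set R) (f df : R -> V) : Prop :=
  (forall t, D t -> is_derive_in D f t (df t)) /\ {within D, continuous df}.

(* Functions on [0, +oo) are represented by total functions whose values at
   negative times are unconstrained. *)
Definition is_trajectory (R : realType) (H : normedModType R)
    (C : set H) (F : H -> H) (lambda : R) (x0 : H) (x y : R -> H) : Prop :=
  exists dx : R -> H,
    [/\ is_C1_in `[0, +oo[ x dx,
        forall t, 0 <= t -> y t = metric_proj C (x t - lambda *: F (x t)),
        forall t, 0 <= t ->
          dx t + x t = y t + lambda *: (F (x t) - F (y t)) &
        x 0 = x0].

(* Main.v *)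
(** Put [w = x - y], [v = y - xs], [G = F x - F y], so that
    [dx = - (w - lambda G)].  The obtuse-angle property of the projection and
    strong pseudo-monotonicity give
    [<w - lambda G, v> >= lambda gamma |v|^2], whence
    [d/dt |x - xs|^2 <= - 2 (1 - lambda L) |w|^2].  The same inequality with
    Cauchy-Schwarz gives [lambda gamma |v| <= (1 + lambda L) |w|], so that
    [|x - xs| <= |w| + |v|] is controlled by [|w|], and Gronwall's lemma
    applies.  The projection itself exists by the parallelogram identity
    applied to a minimizing sequence. *)

Require Import Defs.
From HB Require Import structures.
From mathcomp Require Import all_boot all_order all_algebra.
From mathcomp Require Import all_classical all_reals all_analysis.
From mathcomp Require Import ring lra.

Import Order.TTheory GRing.Theory Num.Theory.
Import numFieldNormedType.Exports.

Local Open Scope classical_set_scope.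
Local Open Scope ring_scope.

(** * Inner product identities and continuity *)

Section InnerProduct.
Context (R : realType) (H : normedModType R) (dot : {dot H for idfun}).
Hypothesis Hdot : induces_norm dot.

Lemma dotC u v : dot u v = dot v u.
Proof. by rewrite hermC expr0 mul1r. Qed.

Lemma normD_sqr u v : `|u + v| ^+ 2 = `|u| ^+ 2 + 2 * dot u v + `|v| ^+ 2.
Proof. by rewrite !Hdot linearDl !linearDr /= (dotC v u); ring. Qed.

Lemma normB_sqr u v : `|u - v| ^+ 2 = `|u| ^+ 2 - 2 * dot u v + `|v| ^+ 2.
Proof. by rewrite normD_sqr normrN linearNr mulrN. Qed.

Lemma dotBD u v : dot (u - v) (u + v) = `|u| ^+ 2 - `|v| ^+ 2.
Proof. by rewrite linearBl/= !linearDr/= (dotC v u) !Hdot; ring. Qed.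

(** Cauchy-Schwarz follows from the triangle inequality for the given norm, squared and expanded. *)
Lemma dot_le_norm u v : dot u v <= `|u| * `|v|.
Proof.
have : `|u + v| ^+ 2 <= (`|u| + `|v|) ^+ 2.
  by rewrite ler_sqr ?nnegrE ?addr_ge0 ?normr_ge0 ?ler_normD.
by rewrite normD_sqr sqrrD; lra.
Qed.

Lemma cvg_dot (T : Type) (G : set_system T) (FG : Filter G) (f g : T -> H)
    (a b : H) :
  f @ G --> a -> g @ G --> b -> dot (f s) (g s) @[s --> G] --> dot a b.
Proof.
move=> fa gb.
(* Polarization reduces continuity of [dot] to that of the norm. *)
have polar u v : dot u v = (`|u + v| ^+ 2 - `|u - v| ^+ 2) / 4.
  by rewrite normD_sqr normB_sqr; field.
rewrite polar; under eq_fun do rewrite polar.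
apply: cvgMl; apply: cvgB; rewrite expr2.
  under eq_fun do rewrite expr2.
  by apply: cvgM; apply: cvg_norm; apply: cvgD.
under eq_fun do rewrite expr2.
by apply: cvgM; apply: cvg_norm; apply: cvgB.
Qed.

End InnerProduct.

(** * Metric projection onto a closed convex set *)

Lemma convex_setP (R : realType) (V : lmodType R) (C : set V)
    (C_convex : convex_set C) (k : R) (a b : V) :
  0 <= k <= 1 -> C a -> C b -> C (k *: a + (1 - k) *: b).
Proof.
move=> /andP[k0 k1] Ca Cb.
have k01 : Itv.spec (@Itv.num_sem R) (Itv.Real `[0, 1]%Z) k.
  by rewrite /Itv.spec/= /Itv.num_sem/= in_itv/= num_real k0 k1.
have := C_convex a b (Itv.mk k01).
by rewrite !inE; apply.
Qed.

(** Moving from [p] towards [z] by a fraction [k] changes the squared distance to [u] by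
    [- 2 * k * a + k ^+ 2 * b], which is negative for small [k] if [a > 0]. *)
Lemma nearest_point_dot_le0 (R : realType) (H : normedModType R)
    (dot : {dot H for idfun}) (Hdot : induces_norm dot)
    (C : set H) (C_convex : convex_set C) (u p z : H) :
  nearest_point C u p -> C z -> dot (u - p) (z - p) <= 0.
Proof.
move=> [Cp pmin] Cz; rewrite leNgt; apply/negP => a_gt0.
set a := dot _ _ in a_gt0; set b := `|z - p| ^+ 2.
have b_ge0 : 0 <= b by rewrite sqr_ge0.
have ab_gt0 : 0 < a + b by lra.
(* This fraction lies in (0, 1], even when [b = 0], and satisfies [k * b = a - k * a < a], whereas
   minimality of [p] forces [2 * a <= k * b]. *)
pose k := a / (a + b).
have k_gt0 : 0 < k by rewrite divr_gt0.
have k_le1 : k <= 1 by rewrite ler_pdivrMr// mul1r lerDl.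
have k01 : 0 <= k <= 1 by rewrite k_le1 ltW.
have := pmin _ (convex_setP _ _ _ C_convex _ _ _ k01 Cz Cp).
have -> : u - (k *: z + (1 - k) *: p) = (u - p) - k *: (z - p).
  by rewrite scalerBl scale1r scalerBr addrCA opprD addrA.
rewrite -ler_sqr ?nnegrE// (normB_sqr _ _ _ Hdot (u - p)) linearZr_LR normrZ.
rewrite exprMn real_normK ?num_real// -/a -/b => /= le_dist.
have kE : k * (a + b) = a by rewrite mulfVK// gt_eqF.
have : k * (2 * a) <= k * (k * b) by rewrite -subr_ge0; nra.
rewrite ler_pM2l// => le_a.
have : k * a > 0 by rewrite mulr_gt0.
nra.
Qed.

Lemma nearest_point_exists (R : realType) (H : completeNormedModType R)
    (dot : {dot H for idfun}) (Hdot : induces_norm dot)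
    (C : set H) (C_nonempty : C !=set0) (C_convex : convex_set C)
    (C_closed : closed C) (u : H) :
  exists p, nearest_point C u p.
Proof.
pose D := [set `|u - z| ^+ 2 | z in C]; set m := inf D.
have D_lb : lbound D 0 by move=> _ [z _ <-]; exact: sqr_ge0.
have D_inf : has_inf D.
  by split; [have [z Cz] := C_nonempty; exists (`|u - z| ^+ 2), z | exists 0].
have m_le z : C z -> m <= `|u - z| ^+ 2.
  by move=> Cz; apply: ge_inf; [exists 0 | exists z].
have /choice[z_ z_min] :
    forall n, exists z, C z /\ `|u - z| ^+ 2 < m + harmonic n.
  move=> n.
  by have [_ [z Cz <-] zm] := inf_adherent (harmonic_gt0 n) D_inf; exists z.
(* The midpoint of [z_ n] and [z_ k] lies in [C], so its squared distance to [u] is at least [m]; in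
   the parallelogram identity the terms [4 * m] cancel. *)
have z_dist n k : `|z_ n - z_ k| ^+ 2 <= 2 * harmonic n + 2 * harmonic k.
  have half01 : 0 <= (2^-1 : R) <= 1 by lra.
  have [[Cn n_lt] [Ck k_lt]] := (z_min n, z_min k).
  have := m_le _ (convex_setP _ _ _ C_convex _ _ _ half01 Cn Ck).
  have -> : 1 - 2^-1 = 2^-1 :> R by field.
  have -> : u - (2^-1 *: z_ n + 2^-1 *: z_ k) =
      2^-1 *: ((u - z_ n) + (u - z_ k)).
    rewrite addrACA -opprD scalerBr -scalerDr; congr (_ - _).
    by rewrite -mulr2n -(scaler_nat 2 u) scalerA mulVf// scale1r.
  have -> : z_ n - z_ k = (u - z_ k) - (u - z_ n).
    by rewrite opprB [RHS]addrC addrA subrK.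
  rewrite normrZ exprMn (normD_sqr _ _ _ Hdot (u - z_ n)).
  rewrite (normB_sqr _ _ _ Hdot (u - z_ k)) (dotC _ _ _ (u - z_ k)).
  have -> : `|2^-1 : R| ^+ 2 = 4^-1 by rewrite ger0_norm//; field.
  lra.
have z_cauchy : cauchy (z_ @ \oo).
  apply: cauchy_exP => e e_gt0.
  have [N _ N_small] : \forall n \near \oo, harmonic n < e ^+ 2 / 4.
    apply: (cvgr_lt (0 : R)); first exact: cvg_harmonic.
    by rewrite divr_gt0// exprn_gt0.
  (* Each of the two terms of [z_dist] is below [e ^+ 2 / 2], so the ball about [z_ N] contains the
     tail. *)
  exists (z_ N), N => // n Nn; rewrite /= -ball_normE/=.
  rewrite -ltr_sqr ?nnegrE ?(ltW e_gt0)//; apply: (le_lt_trans (z_dist _ _)).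
  have N_lt : harmonic N < e ^+ 2 / 4 := N_small _ (leqnn N).
  have n_lt : harmonic n < e ^+ 2 / 4 := N_small _ Nn.
  lra.
have /cauchy_cvgP/cvg_ex[p z_p] := z_cauchy.
exists p; split.
  by apply: (closed_cvg _ C_closed _ _ z_p); apply: nearW => n; case: (z_min n).
move=> z Cz; rewrite -ler_sqr ?nnegrE//; apply: (le_trans _ (m_le _ Cz)).
have p_lim : `|u - z_ n| ^+ 2 @[n --> \oo] --> `|u - p| ^+ 2.
  rewrite expr2; under eq_fun do rewrite expr2.
  by apply: cvgM; apply: cvg_norm; apply: cvgB => //; exact: cvg_cst.
have m_lim : m + harmonic n @[n --> \oo] --> m.
  rewrite -[X in _ --> X]addr0; apply: cvgD; first exact: cvg_cst.
  exact: cvg_harmonic.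
apply: (ler_cvg_to p_lim m_lim).
by apply: nearW => n; case: (z_min n) => _ /ltW.
Qed.

Lemma metric_projP (R : realType) (H : completeNormedModType R)
    (dot : {dot H for idfun}) (Hdot : induces_norm dot)
    (C : set H) (C_nonempty : C !=set0) (C_convex : convex_set C)
    (C_closed : closed C) (u : H) :
  nearest_point C u (metric_proj C u).
Proof. by apply: xgetPex; exact: (nearest_point_exists _ _ _ Hdot). Qed.

(** * Dissipation inequality at a frozen time: [x], [y] and [dx] are single vectors *)

Lemma forward_backward_forward_dissipation (R : realType) (H : normedModType R)
    (dot : {dot H for idfun}) (Hdot : induces_norm dot)
    (C : set H) (C_convex : convex_set C) (F : H -> H) (gamma L : R)
    (gamma_gt0 : 0 < gamma)
    (F_pseudomonotone : strongly_pseudomonotone_on dot gamma C F)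
    (L_gt0 : 0 < L) (F_lipschitz : L.-lipschitz F)
    (lambda : R) (lambda_gt0 : 0 < lambda) (lambda_lt : lambda < 1 / L)
    (xs : H) (xs_solution : VI_solution dot F C xs) (x y dx : H)
    (y_proj : nearest_point C (x - lambda *: F x) y)
    (dxE : dx + x = y + lambda *: (F x - F y)) :
  let alpha := 2 * (1 - lambda * L) *
    ((lambda * gamma) / (1 + lambda * L + lambda * gamma)) ^+ 2 in
  2 * dot dx (x - xs) <= - alpha * `|x - xs| ^+ 2.
Proof.
have [Cxs xs_VI] := xs_solution; have Cy : C y by case: y_proj.
have proj_ge := nearest_point_dot_le0 _ _ _ Hdot _ C_convex _ _ _ y_proj Cxs.
have Fy_ge := F_pseudomonotone _ _ Cxs Cy (xs_VI _ Cy).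
have F_lip : `|F x - F y| <= L * `|x - y| by exact: (F_lipschitz (x, y)).
set w := x - y in F_lip; set v := y - xs; set G := F x - F y in F_lip dxE.
have -> : x - xs = w + v by rewrite /w /v addrA subrK.
have {dxE} -> : dx = - (w - lambda *: G).
  by rewrite -(addrK x dx) dxE /w !opprB addrAC addrC.
(* Writing [F x] as [G + F y] in the obtuse-angle inequality at [y], tested with [xs], bounds the
   right side below by [lambda * dot (F y) v], to which strong pseudo-monotonicity applies. *)
have step_ge : lambda * gamma * `|v| ^+ 2 <= dot (w - lambda *: G) v.
  move: proj_ge Fy_ge; rewrite distrC -/v.
  have -> : x - lambda *: F x - y = w - lambda *: G - lambda *: F y.
    rewrite /w /G scalerBr opprB -[RHS]addrA (addrAC (lambda *: F y)).
    by rewrite subrr add0r addrAC.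
  rewrite -(opprB y xs) -/v linearNr linearBl/= linearZl_LR/=.
  by move=> proj_ge Fy_ge; nra.
have step_le : `|w - lambda *: G| <= (1 + lambda * L) * `|w|.
  apply: (le_trans (ler_normB _ _)).
  by rewrite normrZ (gtr0_norm lambda_gt0); nra.
have G_le := dot_le_norm _ _ _ Hdot G w.
have dot_step := dot_le_norm _ _ _ Hdot (w - lambda *: G) v.
have wv_le := ler_normD w v.
have dotE : dot (w - lambda *: G) (w + v) =
    `|w| ^+ 2 - lambda * dot G w + dot (w - lambda *: G) v.
  by rewrite linearDr/= linearBl/= linearZl_LR/= Hdot.
have lL : lambda * L < 1 by rewrite -ltr_pdivlMr.
rewrite linearNl/= dotE; set a := `|w| in F_lip step_le G_le wv_le *.
set b := `|v| in step_ge dot_step wv_le *; set c := `|w + v| in wv_le *.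
have [a_ge0 b_ge0 c_ge0] : [/\ 0 <= a, 0 <= b & 0 <= c].
  by split; exact: normr_ge0.
set d := dot _ v in step_ge dot_step *.
have m_gt0 : 0 < lambda * L by rewrite mulr_gt0.
have g_gt0 : 0 < lambda * gamma by rewrite mulr_gt0.
have Gw_le : lambda * dot G w <= lambda * L * a ^+ 2.
  rewrite -mulrA ler_pM2l//; apply: (le_trans G_le).
  by rewrite expr2 mulrA ler_wpM2r.
(* Both bounds on [d] carry a factor [b], which can be cancelled only when it is nonzero. *)
have b_le : lambda * gamma * b <= (1 + lambda * L) * a.
  have [->|b_neq0] := eqVneq b 0; first by rewrite mulr0; nra.
  have b_gt0 : 0 < b by rewrite lt0r b_neq0.
  rewrite -(ler_pM2r b_gt0); apply: (@le_trans _ _ d); first by nra.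
  by apply: (le_trans dot_step); rewrite ler_wpM2r.
set g := lambda * gamma in g_gt0 step_ge b_le *.
set m := lambda * L in m_gt0 lL step_le Gw_le b_le *.
have s_gt0 : 0 < 1 + m + g by lra.
(* Adding [g * a] to [b_le] and using [c <= a + b] gives [g * c <= (1 + m + g) * a]; this is the
   origin of the squared fraction in [alpha]. *)
have c_le : g / (1 + m + g) * c <= a.
  by rewrite mulrAC ler_pdivrMr//; nra.
have : (g / (1 + m + g) * c) ^+ 2 <= a ^+ 2.
  by rewrite ler_sqr ?nnegrE// mulr_ge0// divr_ge0// ltW.
rewrite exprMn => sqr_le; set q := _ ^+ 2 in sqr_le *.
have : 0 <= g * b ^+ 2 by rewrite mulr_ge0 ?sqr_ge0// ltW.
have : (1 - m) * (q * c ^+ 2) <= (1 - m) * a ^+ 2 by rewrite ler_wpM2l//; lra.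
nra.
Qed.

(** * Derivatives relative to a domain *)

Lemma is_derive_in_cvg (R : realType) (V : normedModType R) (D : set R)
    (f : R -> V) (t : R) (v : V) :
  is_derive_in D f t v -> f s @[s --> within D (nbhs t)] --> f t.
Proof.
rewrite /is_derive_in => fv.
have FD : Filter (within D t^') by exact: within_filter.
have id_cvg : s - t @[s --> within D t^'] --> (0 : R).
  rewrite -(subrr t); apply: cvgB; last exact: cvg_cst.
  by do 2 apply: cvg_within_filter; exact: cvg_id.
have punctured : f s @[s --> within D t^'] --> f t.
  have : f t + (s - t) *: ((s - t)^-1 *: (f s - f t)) @[s --> within D t^']
      --> f t + (0 : R) *: v.
    apply: cvgD; first exact: cvg_cst.
    exact: (cvgZ (FF := FD) id_cvg fv).
  rewrite scale0r addr0; apply: cvg_trans; apply: near_eq_cvg.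
  rewrite near_withinE near_withinE; apply: nearW => s s_neq _.
  by rewrite scalerA divff ?subr_eq0// scale1r addrC subrK.
(* The limit so far ignores [s = t]; that point is restored by hand, since [f t] belongs to each of
   its neighbourhoods. *)
move=> A fA.
have near_t : nbhs t [set s | s != t -> D s -> A (f s)] := punctured A fA.
change (nbhs t [set s | D s -> A (f s)]); apply: filterS near_t => s As Ds.
have [->|s_neq] := eqVneq s t; first exact: (nbhs_singleton fA).
exact: As.
Qed.

(** Bridge to the two-sided derivative, so that the usual product and chain rules become available
    at positive times. *)
Lemma is_derive_in_interior (R : realType) (V : normedModType R) (D : set R)
    (f : R -> V) (t : R) (v : V) :
  nbhs t D -> is_derive_in D f t v -> is_derive t 1 f v.
Proof.
move=> tD fv.
have shift_cvg : h + t @[h --> (0 : R)] --> t.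
  rewrite -[X in _ --> X]add0r.
  by apply: cvgD; [exact: cvg_id | exact: cvg_cst].
have q_cvg : h^-1 *: ((f \o shift t) (h *: 1) - f t) @[h --> 0^'] --> v.
  have : (h + t - t)^-1 *: (f (h + t) - f t) @[h --> 0^'] --> v.
    move=> A vA.
    have near_t : nbhs t [set s | s != t -> D s ->
      A ((s - t)^-1 *: (f s - f t))] := fv A vA.
    change (nbhs (0 : R) [set h : R | h != 0 ->
      A ((h + t - t)^-1 *: (f (h + t) - f t))]).
    have near_0 : nbhs (0 : R) [set h | ((h + t != t -> D (h + t) ->
      A ((h + t - t)^-1 *: (f (h + t) - f t))) /\ D (h + t))] :=
      shift_cvg _ (@filterI _ _ (nbhs_filter t) _ _ near_t tD).
    apply: filterS near_0 => h [Ah Dh] h_neq0.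
    by apply: Ah Dh; rewrite -subr_eq0 addrK.
  apply: cvg_trans; apply: near_eq_cvg; apply: nearW => h.
  by rewrite /= addrK [h *: 1]mulr1.
split; first by apply/cvg_ex; exists v.
exact: cvg_lim q_cvg.
Qed.

(** By [dotBD] a difference of squared norms factors, so the difference quotient is [dot] of the
    quotient of [f] with a sum tending to [2 * (f t - a)]. *)
Lemma is_derive_in_sqr_norm (R : realType) (H : normedModType R)
    (dot : {dot H for idfun}) (Hdot : induces_norm dot) (D : set R)
    (f : R -> H) (t : R) (v a : H) :
  is_derive_in D f t v ->
  is_derive_in D (fun s => `|f s - a| ^+ 2) t (2 * dot v (f t - a)).
Proof.
move=> fv; have f_cvg := is_derive_in_cvg _ _ _ _ _ _ fv.
have f_cvg' : f s @[s --> within D t^'] --> f t.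
  move=> A /f_cvg; rewrite /= !nbhs_simpl /= /within /=.
  by apply: cvg_within.
have -> : 2 * dot v (f t - a) = dot v ((f t - a) + (f t - a)).
  by rewrite linearDr/=; ring.
have : dot ((s - t)^-1 *: (f s - f t)) ((f s - a) + (f t - a))
    @[s --> within D t^'] --> dot v ((f t - a) + (f t - a)).
  apply: cvg_dot => //; apply: cvgD; last exact: cvg_cst.
  by apply: cvgB => //; exact: cvg_cst.
apply: cvg_trans; apply: near_eq_cvg; apply: nearW => s.
rewrite linearZl_LR/=; congr (_ * _).
have -> : f s - f t = (f s - a) - (f t - a) by rewrite opprB addrA subrK.
exact: dotBD.
Qed.

Lemma within_continuous_derive_in (R : realType) (V : normedModType R)
    (D : set R) (f df : R -> V) :
  (forall t, D t -> is_derive_in D f t (df t)) -> {within D, continuous f}.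
Proof.
move=> f_df; apply/subspace_continuousP => t Dt.
exact: is_derive_in_cvg (f_df t Dt).
Qed.

(** With the integrating factor [expR (a * s)], the product [psi] has derivative
    [expR (a * s) * (dphi s + a * phi s) <= 0]. *)
Lemma gronwall_exp (R : realType) (phi dphi : R -> R) (a : R) :
  (forall t : R, 0 <= t -> is_derive_in `[0, +oo[ phi t (dphi t)) ->
  (forall t : R, 0 <= t -> dphi t <= - a * phi t) ->
  forall t : R, 0 <= t -> phi t <= phi 0 * expR (- a * t).
Proof.
move=> phi_d dphi_le t t_ge0.
have phi_d' (s : R) : s \in `]0, +oo[ -> is_derive s 1 phi (dphi s).
  rewrite in_itv/= andbT => s_gt0.
  apply: (is_derive_in_interior _ _ `[0, +oo[); last exact/phi_d/ltW.
  apply: (@filterS _ _ (nbhs_filter s) `]0, +oo[).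
    by apply: subset_itvr; rewrite bnd_simp.
  apply: open_nbhs_nbhs; split; first exact: interval_open.
  by rewrite /= in_itv/= s_gt0.
pose psi (s : R) : R := phi s * expR (a * s).
have psi_d (s : R) : s \in `]0, +oo[ ->
    is_derive s 1 psi (phi s *: (expR (a * s) * a) + expR (a * s) *: dphi s).
  move=> /phi_d' phi_s.
  apply: is_deriveM.
  apply: (@is_derive1_comp _ expR ( *%R a)).
  rewrite -[X in is_derive _ _ _ X]mulr1.
  exact: is_deriveZ.
suff : psi t <= psi 0.
  rewrite /psi mulr0 expR0 mulr1 => psi_le.
  by rewrite mulNr expRN ler_pdivlMr ?expR_gt0.
(* The sign of the derivative is checked on the open half-line only; continuity of [psi] within the
   closed one covers the endpoint 0. *)
apply: (ler0_derive1_nincry (a := 0)) => //.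
- by move=> s /psi_d[].
- move=> s s_in; have psi_s := psi_d s s_in; rewrite derive1E derive_val.
  have := dphi_le s; move: s_in; rewrite in_itv/= andbT => /ltW s_ge0.
  move=> /(_ s_ge0) le_s; have e_gt0 := expR_gt0 (a * s).
  by rewrite /GRing.scale/=; nra.
- have phi_c : {within `[0, +oo[, continuous phi}.
    apply: (within_continuous_derive_in _ _ _ _ dphi) => s.
    by rewrite /= in_itv/= andbT; exact: phi_d.
  move=> s; apply: cvgM; first exact: phi_c.
  apply: continuous_subspaceT => r; apply: continuous_comp;
    last exact: continuous_expR.
  by apply: cvgM; [exact: cvg_cst | exact: cvg_id].
Qed.

Theorem theorem2p2 (R : realType) (H : completeNormedModType R)
    (dot : {dot H for idfun}) (Hdot : induces_norm dot)
    (C : set H) (C_nonempty : C !=set0) (C_convex : convex_set C)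
    (C_closed : closed C)
    (F : H -> H) (gamma L : R)
    (gamma_gt0 : 0 < gamma)
    (F_pseudomonotone : strongly_pseudomonotone_on dot gamma C F)
    (L_gt0 : 0 < L) (F_lipschitz : L.-lipschitz F)
    (lambda : R) (lambda_gt0 : 0 < lambda) (lambda_lt : lambda < 1 / L)
    (x0 : H) (x y : R -> H)
    (xy_trajectory : is_trajectory C F lambda x0 x y)
    (xs : H) (xs_solution : VI_solution dot F C xs) :
  let alpha := 2 * (1 - lambda * L) *
    ((lambda * gamma) / (1 + lambda * L + lambda * gamma)) ^+ 2 in
  forall t : R, 0 <= t ->
    `|x t - xs| ^+ 2 <= `|x 0 - xs| ^+ 2 * expR (- alpha * t).
Proof.
have [dx [[x_d _] yE dxE x0E]] := xy_trajectory.
move=> alpha t t_ge0.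
apply: (gronwall_exp _ (fun s => `|x s - xs| ^+ 2)
  (fun s => 2 * dot (dx s) (x s - xs))) => // s s_ge0.
  apply: is_derive_in_sqr_norm => //; apply: x_d.
  by rewrite /= in_itv/= s_ge0.
apply: (forward_backward_forward_dissipation _ _ _ Hdot C C_convex F _ _
  gamma_gt0 F_pseudomonotone L_gt0 F_lipschitz _ lambda_gt0 lambda_lt
  _ xs_solution _ (y s)); last exact: dxE.
by rewrite yE//; exact: (metric_projP _ _ _ Hdot).
Qed.
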